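(* Let $q$ be a positive integer and $0<\alpha\le\frac12$, and let $A$ be the largest integer such that $\lceil q/A\rceil-1\ge\alpha(q-1)$. There is a constant $c_q$ depending only on $q$ such that if $n$ is large enough, then after asking all $\binom{n}{q}$ possible queries of size $q$ among $n$ balls, we can name a $c_q$-almost $\frac1A$-ball of the full set, i.e. a ball that is a $c_q$-almost $\frac1A$-ball of the full set in every coloring consistent with the answers.
   Context: There are $n$ balls, each colored with one of two colors in an unknown way. For $0<\beta\le1$, a ball $b$ is a $\beta$-ball of a set $S$ of balls containing $b$ if there are at least $\beta(|S|-1)$ other balls in $S$ with the same color as $b$; for a constant $c$, $b$ is a $c$-almost $\beta$-ball of $S$ if there are at least $\beta(|S|-1)-c$ other balls in $S$ with the same color as $b$. A query is a set $Q$ of $q$ balls and the answer is (the index of) some $\alpha$-ball of $Q$, chosen adversarially. *)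

(* Defs.v *)
From HB Require Import structures.
From mathcomp Require Import all_boot all_order all_algebra.
From mathcomp Require Import reals.

Set Implicit Arguments.
Unset Strict Implicit.
Unset Printing Implicit Defensive.

Import Order.TTheory GRing.Theory Num.Theory.
Local Open Scope ring_scope.

Section Balls.
Variables (R : realType) (n : nat).
Implicit Types (col : 'I_n -> bool) (S Q : {set 'I_n}) (b : 'I_n).

Definition same_color_others col S b : {set 'I_n} :=
  [set x in S | (x != b) && (col x == col b)].

Definition beta_ball (beta : R) col S b : Prop :=
  b \in S /\ beta * (#|S|%:R - 1) <= #|same_color_others col S b|%:R.

Definition almost_beta_ball (c beta : R) col S b : Prop :=
  b \in S /\ beta * (#|S|%:R - 1) - c <= #|same_color_others col S b|%:R.

(* Only the values of [ans] on sets of size [q] are relevant. *)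
Definition consistent (q : nat) (alpha : R) (ans : {set 'I_n} -> 'I_n) col
    : Prop :=
  forall Q, #|Q| = q -> beta_ball alpha col Q (ans Q).

End Balls.

(* [A != 0] rules out the conventional value of q / 0. *)
Definition admissible (R : realType) (q : nat) (alpha : R) (A : int) : Prop :=
  A != 0 /\
  alpha * (q%:R - 1) <= (Num.ceil (q%:R / A%:~R : R) - 1)%:~R.

Definition largest_admissible (R : realType) (q : nat) (alpha : R) (A : int)
    : Prop :=
  admissible q alpha A /\ forall B : int, admissible q alpha B -> B <= A.

(* Main.v *)
Require Import Defs.
From HB Require Import structures.
From mathcomp Require Import all_boot all_order all_algebra.
From mathcomp Require Import reals.
From mathcomp Require Import boolp zify lra.

Import Order.TTheory GRing.Theory Num.Theory.
Local Open Scope ring_scope.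

(** If the conclusion fails, every ball lies in a color class of size less than
    [n / A - c] of some consistent coloring, and these small classes cover the
    balls. Put [t := ceil (q / (A + 1))]; since [A + 1] is not admissible, the
    answer to a query cannot lie in a class meeting the query in at most [t]
    balls. It thus suffices to find a query covered by small classes each
    meeting it in at most [t] balls. A minimal cover with at least [q] classes
    yields one by picking a private ball of each class. Otherwise discard, one
    after the other, the classes with fewer than [t] private balls: this
    uncovers at most [q * t] balls, so more than [A] classes remain by their
    size, and [t] private balls of each contain a query as [q <= (A + 1) * t]. *)

Section PrivateElements.
Local Open Scope nat_scope.
Context {T : finType}.
Implicit Types (F G : {set {set T}}) (B Q : {set T}).

Definition private_part G B : {set T} := B :\: cover (G :\ B).

Definition take_set m (S : {set T}) : {set T} := [set x in take m (enum S)].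

Lemma take_set_sub m (S : {set T}) : take_set m S \subset S.
Proof. by apply/subsetP => x; rewrite inE => /mem_take; rewrite mem_enum. Qed.

Lemma card_take_set m (S : {set T}) : m <= #|S| -> #|take_set m S| = m.
Proof.
move=> le_mS; rewrite cardsE (card_uniqP (take_uniq _ (enum_uniq _))).
by rewrite size_take_min -cardE; apply/minn_idPl.
Qed.

Lemma uncovered_setD1 G B :
  B \in G -> #|~: cover (G :\ B)| <= #|~: cover G| + #|private_part G B|.
Proof.
move=> GB; rewrite -(cardsUI (~: cover G)); apply: leq_trans (leq_addr _ _).
apply/subset_leq_card/subsetP => x; rewrite !inE => xNG; rewrite xNG /=.
case: (boolP (x \in B)) => [_|xNB]; first by rewrite orbT.
rewrite orbF; apply: contra xNG => /bigcupP[C GC xC].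
apply/bigcupP; exists C => //; rewrite !inE GC andbT.
by apply: contraNneq xNB => <-.
Qed.

(** Private parts are pairwise disjoint, so choosing [t] private elements of each member gives
    [#|G| * t] elements, of which each member contains only its own [t]; [Q] consists of [q] of
    them. *)
Lemma sparse_transversal G t q :
    (forall B, B \in G -> t <= #|private_part G B|) -> q <= #|G| * t ->
  exists Q : {set T}, [/\ #|Q| = q, Q \subset cover G
              & forall B, B \in G -> #|Q :&: B| <= t].
Proof.
move=> privG leq_q.
pose s B := take_set t (private_part G B).
(* The value [set0] outside [G] makes the family disjoint over all sets, as
   [partition_disjoint_bigcup] requires. *)
pose s' B := if B \in G then s B else set0.
have card_s B : B \in G -> #|s B| = t by move=> /privG/card_take_set.
have s_inj B C x : B \in G -> C \in G -> x \in s B -> x \in C -> B = C.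
  move=> GB GC /(subsetP (take_set_sub _ _)); rewrite inE => /andP[xNB _] xC.
  apply/esym/eqP; apply: contraNT xNB => neCB.
  by apply/bigcupP; exists C => //; rewrite !inE neCB.
have s_sub B : s B \subset B.
  by apply: subset_trans (take_set_sub _ _) (subsetDl _ _).
have s'E B x : x \in s' B -> B \in G /\ x \in s B.
  by rewrite /s'; case: ifP => //; rewrite inE.
have disj B C : B != C -> [disjoint s' B & s' C].
  move=> neBC; apply/pred0P => x /=; apply: contraNF neBC => /andP[].
  move=> /s'E[GB xB] /s'E[GC xC]; apply/eqP/(s_inj _ _ x) => //.
  exact: (subsetP (s_sub C)).
have cardU : #|\bigcup_B s' B| = #|G| * t.
  rewrite -sum1_card (partition_disjoint_bigcup addn) // -sum_nat_const.
  rewrite [RHS]big_mkcond /=; apply: eq_bigr => B _; rewrite sum1_card /s'.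
  by case: ifP => [/card_s //|_]; rewrite cards0.
have sQU := take_set_sub q (\bigcup_B s' B).
exists (take_set q (\bigcup_B s' B)); split => [||B GB].
    by rewrite card_take_set // cardU.
  apply/subsetP => x /(subsetP sQU)/bigcupP[B _ /s'E[GB xB]].
  by apply/bigcupP; exists B => //; exact: (subsetP (s_sub B)).
rewrite -(card_s B GB); apply/subset_leq_card/subsetP => x; rewrite inE.
case/andP => /(subsetP sQU)/bigcupP[C _ /s'E[GC xC]] xB.
by rewrite -(s_inj C B x GC GB xC xB).
Qed.

(** Minimality forbids passing to [G :\ B]. Choosing a minimal family thus replaces the removal of
    members one by one. *)
Lemma minset_private_part (P : pred {set {set T}}) G t :
    (forall B, B \in G -> #|private_part G B| < t -> P (G :\ B)) ->
  minset P G -> forall B, B \in G -> t <= #|private_part G B|.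
Proof.
move=> PD1 /minsetP[_ minG] B GB; case: leqP => // /(PD1 B GB) /minG.
by move=> /(_ (subsetDl _ _))/setP/(_ B); rewrite !inE GB eqxx.
Qed.

(** The last hypothesis ensures that any [a] members of [F] leave more than [q * t] elements
    uncovered. *)
Lemma sparse_set_of_small_cover F a t q :
    0 < t -> q <= a.+1 * t -> cover F = setT -> q * t < #|T| ->
    (forall B, B \in F -> a * #|B| + q * t < #|T|) ->
  exists2 Q : {set T}, #|Q| = q &
    forall x, x \in Q -> exists B, [/\ B \in F, x \in B & #|Q :&: B| <= t].
Proof.
move=> t_gt0 le_q covF T_big smallF.
(* Used with [u = 1] for a minimal cover with at least [q] members, and with [u = t] for what
   remains after discarding otherwise. *)
have sparse G u : G \subset F -> u <= t ->
    (forall B, B \in G -> u <= #|private_part G B|) -> q <= #|G| * u ->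
  exists2 Q : {set T}, #|Q| = q &
    forall x, x \in Q -> exists B, [/\ B \in F, x \in B & #|Q :&: B| <= t].
  move=> sGF le_ut privG le_qG.
  have [Q [cardQ sQ QB]] := sparse_transversal G u q privG le_qG.
  exists Q => // x /(subsetP sQ)/bigcupP[B GB xB].
  by exists B; split=> //; [exact: (subsetP sGF)|exact: leq_trans (QB B GB) _].
have [M minM sMF] :=
  @minset_exists _ (fun G => #|~: cover G| == 0) F
    ltac:(by rewrite /= covF setCT cards0).
have /eqP covM := minsetp minM.
have [le_qM|lt_Mq] := leqP q #|M|.
  apply: (sparse M 1) => //; last by rewrite muln1.
  apply: minset_private_part minM => B MB; rewrite ltnS leqn0 => /eqP priv0.
  by have := uncovered_setD1 M B MB; rewrite covM priv0 leqn0.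
(* Dropping a set with fewer than [t] private elements preserves the bound. *)
have [G minG sGM] :=
  @minset_exists _ (fun G => #|~: cover G| + #|G| * t <= q * t) M
    ltac:(by rewrite /= covM add0n leq_mul2r ltnW ?orbT).
have sGF := subset_trans sGM sMF.
have uncG := minsetp minG.
apply: (sparse G t) => //.
  apply: minset_private_part minG => B GB privB.
  have := uncovered_setD1 G B GB.
  move: uncG; rewrite /= (cardsD1 B G) GB mulnDl mul1n.
  move: privB; set u := #|~: cover (G :\ B)|; set v := #|G :\ B| * t.
  by lia.
apply: leq_trans le_q _; rewrite leq_mul2r; apply/orP; right; rewrite ltnNge.
apply/negP => le_Ga.
(* With at most [a] members, [G] leaves more than [q * t] elements uncovered, against [uncG]. *)
have := cardsC (cover G); have : #|cover G| + q * t < #|T|; last lia.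
have [->|[B0 GB0]] := set_0Vmem G; first by rewrite /cover big_set0 cards0.
have G_gt0 : 0 < #|G| by apply/card_gt0P; exists B0.
have [B GB maxB] := eq_bigmax_cond (fun B : {set T} => #|B|) G_gt0.
apply: leq_ltn_trans (smallF B (subsetP sGF B GB)); rewrite leq_add2r.
apply: leq_trans (leq_card_cover G) _; rewrite -maxB.
apply: leq_trans (_ : #|G| * \max_(C in G) #|C| <= _); last first.
  by rewrite leq_mul2r le_Ga orbT.
rewrite -sum_nat_const; apply: leq_sum => C GC; exact: leq_bigmax_cond.
Qed.

End PrivateElements.

Section Queries.
Context {R : realType}.
Implicit Types (q : nat) (alpha : R) (A : int).

(** The last inequality is the failure of admissibility for [A + 1]. Since [alpha <= 1], the integer
    1 is admissible, which makes [A] positive. *)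
Lemma largest_admissibleP q alpha A :
    (0 < q)%N -> alpha <= 1 -> largest_admissible q alpha A ->
  exists a t : nat, [/\ A = a%:Z, (0 < a)%N, (0 < t <= q)%N,
    (q <= a.+1 * t)%N & t%:R - 1 < alpha * (q%:R - 1)].
Proof.
move=> q_gt0 alpha_le1 [_ maxA].
have q_ge1 : 1 <= q%:R :> R by rewrite ler1n.
have A_ge1 : 1 <= A.
  apply: maxA; split=> //; rewrite divr1 (pmulrn 1 q) intrKceil.
  by rewrite intrB -pmulrn; apply: ler_piMl => //; lra.
case: A maxA A_ge1 => [a|//] maxA a_gt0.
have a1_gt0 : 0 < (a%:Z + 1)%:~R :> R by rewrite ltr0z; lia.
set x : R := q%:R / (a%:Z + 1)%:~R.
have x_gt0 : 0 < x by rewrite divr_gt0 // ltr0n.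
have [t tE] : exists t : nat, Num.ceil x = t%:Z.
  have := x_gt0; rewrite -ceil_gt0; case: (Num.ceil x) => // t _; by exists t.
exists a, t; split => //.
- rewrite -ltz_nat -lez_nat -tE ceil_gt0 x_gt0 /= ceil_le_int -pmulrn.
  by rewrite ler_pdivrMr // ler_peMr ?ler0n // ler1z lerDr.
- rewrite -(ler_nat R) natrM -[a.+1%:R]/(a.+1%:Z%:~R) -addn1 PoszD.
  by rewrite -ler_pdivrMl // mulrC; have := ceil_ge x; rewrite tE.
rewrite ltNge; apply/negP => adm.
suff: a%:Z + 1 <= a%:Z by rewrite gerDl.
apply: maxA; split; first by lia.
by rewrite -/x tE intrB.
Qed.

(** The successor counts [b] itself: at most [t] balls of a class in a query means at most [t - 1]
    others. *)
Lemma card_color_class n (col : 'I_n -> bool) (S : {set 'I_n}) (b : 'I_n) :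
  b \in S ->
  #|S :&: [set x | col x == col b]| = #|same_color_others col S b|.+1.
Proof.
move=> Sb; rewrite (cardsD1 b) !inE Sb eqxx; congr _.+1.
by apply: eq_card => x; rewrite !inE andbCA.
Qed.

End Queries.

Theorem theorem19 (R : realType) (q : nat) (hq : (0 < q)%N) :
  exists c : R, forall (alpha : R) (A : int),
    0 < alpha -> alpha <= 1 / 2 -> largest_admissible q alpha A ->
    exists n0 : nat, forall n : nat, (n0 <= n)%N ->
    forall ans : {set 'I_n} -> 'I_n,
    exists b : 'I_n, forall col : 'I_n -> bool,
      consistent q alpha ans col ->
      almost_beta_ball c (1 / A%:~R) col [set: 'I_n] b.
Proof.
(* As [t <= q], the term [q * q] bounds [q * t] whatever [alpha] is; the extra 1 accounts for [b],
   which [same_color_others] omits. *)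
exists (q * q).+1%:R => alpha A _ alpha_le /largest_admissibleP.
case=> // [|a [t [-> a_gt0 /andP[t_gt0 le_tq] le_q lt_t]]]; first by lra.
exists (q * q).+1 => n lt_n ans; apply: contrapT => no_ball.
pose small (B : {set 'I_n}) := (a * #|B| + q * q < n)%N.
pose F := [set B : {set 'I_n} | `[< small B /\
  exists col b, consistent q alpha ans col /\ B = [set x | col x == col b] >]].
have covF : cover F = setT.
  (* A ball outside the cover has no small class in any consistent coloring, so it could be
     named. *)
  apply/setP => b; rewrite inE; apply: contrapT => /negP bNF.
  apply: no_ball; exists b => col cons_col; apply: contrapT => bad.
  have [] := negP bNF; apply/bigcupP.
  exists [set x | col x == col b]; last by rewrite inE.
  rewrite inE; apply/asboolP; split; last by exists col, b.
  have := card_color_class n col setT b (in_setT b); rewrite setTI => cardB.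
  rewrite /small cardB; set m := #|_| in bad *.
  rewrite ltnNge; apply/negP => big; apply: bad; split; first by rewrite inE.
  rewrite cardsT card_ord -/m lerBlDr mul1r ler_pdivrMl; last by rewrite ltr0n.
  rewrite lerBlDr -[a%:Z%:~R]/(a%:R) -natrD -natrM natr1 ler_nat; nia.
have [||Q cardQ Q_sparse] :=
  sparse_set_of_small_cover F a t q t_gt0 le_q covF.
- by rewrite card_ord; nia.
- by move=> B; rewrite card_ord inE => /asboolP[+ _]; rewrite /small; nia.
(* Some consistent coloring exists, because [F] covers the ball number [q * q]; it shows that
   [ans Q] lies in [Q]. *)
have /bigcupP[B0] : Ordinal lt_n \in cover F by rewrite covF inE.
rewrite inE => /asboolP[_ [col0 [_ [cons0 _]]]] _.
have [QansQ _] := cons0 Q cardQ.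
have [B [FB ansB le_QB]] := Q_sparse _ QansQ.
(* [B] may come from a coloring other than [col0], but [ans Q] must be an [alpha]-ball of [Q] for
   that one too. *)
move: FB; rewrite inE => /asboolP[_ [col [b [cons_col defB]]]].
have [_] := cons_col Q cardQ.
apply/negP; rewrite -ltNge cardQ; apply: le_lt_trans lt_t.
rewrite lerBrDr natr1 ler_nat -card_color_class //.
move: ansB le_QB; rewrite defB inE => /eqP <-; exact.
Qed.
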